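(* Let $p$ in $\mathbb{Z}$ be a prime congruent to $2$ or $5$ modulo $9$, and let $M$ be an associate in $\mathcal{O}$ of $p$ or of $p^{2}$. If $M\ne 2$ and $M\neq -2$, there are no $x$ and $y$ in $\mathcal{K}$ with $x^{3}+y^{3}=M$. When $M=2$, the only solutions $(x,y)\in\mathcal{K}^2$ of $x^{3}+y^{3}=M$ are the nine with $x^{3}=1$ and $y^{3}=1$. When $M=-2$, the only solutions $(x,y)\in\mathcal{K}^2$ are the nine with $x^{3}=-1$ and $y^{3}=-1$.
   Context: Let $u$ and $v$ be the two roots in $\mathbb{C}$ of $z^{2}+z+1=0$ (so $u,v$ are the primitive cube roots of unity). $\mathcal{O}$ is the set of $\mathbb{Z}$-linear combinations of $1,u,v$ (the ring of Eisenstein integers) and $\mathcal{K}$ is the set of $\mathbb{Q}$-linear combinations of $1,u,v$ (its field of fractions). Two elements of $\mathcal{O}$ are associates if each is the product of the other by a unit of $\mathcal{O}$; the units are $\pm1,\pm u,\pm v$. *)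

(* Defs.v *)
From HB Require Import structures.
From mathcomp Require Import all_boot all_order all_algebra.
From mathcomp Require Import complex.
From mathcomp Require Import boolp classical_sets functions cardinality reals.

Set Implicit Arguments.
Unset Strict Implicit.
Unset Printing Implicit Defensive.

Import Order.TTheory GRing.Theory Num.Theory.
Local Open Scope classical_set_scope.
Local Open Scope ring_scope.

Section Eisenstein.
Variables (C : fieldType) (u v : C).

Definition two_roots : Prop :=
  u != v /\ (forall z : C, z ^+ 2 + z + 1 = 0 <-> z = u \/ z = v).

Definition eisO : set C :=
  [set z | exists a b c : int, z = a%:~R + b%:~R * u + c%:~R * v].

(* [ratr] is the embedding of the rationals only in characteristic 0. *)
Definition eisK : set C :=
  [set z | exists a b c : rat, z = ratr a + ratr b * u + ratr c * v].

Definition eis_unit (e : C) : Prop :=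
  eisO e /\ exists f : C, eisO f /\ e * f = 1.

Definition eis_associates (x y : C) : Prop :=
  [/\ eisO x, eisO y,
      exists e : C, eis_unit e /\ x = y * e &
      exists e : C, eis_unit e /\ y = x * e].

Definition cube_solutions (M : C) : set (C * C) :=
  [set xy | eisK xy.1 /\ eisK xy.2 /\ xy.1 ^+ 3 + xy.2 ^+ 3 = M].

Definition cubes_equal (c : C) : set (C * C) :=
  [set xy | eisK xy.1 /\ eisK xy.2 /\ xy.1 ^+ 3 = c /\ xy.2 ^+ 3 = c].

End Eisenstein.

(* Main.v *)
(** The proof is a descent in the Eisenstein integers [Z[w]], with
    [l = 1 - w] the prime above 3.  For coprime [x], [y] with
    [x^3 + y^3 = M z^3], put [A = x + y], [B = w (x + w y)] and
    [C = w^2 (x + w^2 y)], so that [A + B + C = 0] and [ABC = M z^3].  After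
    division by [1] or [l] the three become pairwise coprime; [p] is inert, so
    the whole [p]-part of [M] sits in one of them, say [A] (multiply [y] by a
    power of [w]), and unique factorization makes the others units times cubes.
    Hence [b^3 + f c^3 + g M a^3 = 0] with units [f], [g].  Cubes are [0] or
    [+-1] modulo [l^3], and [p], [p^2] are not [+-1] modulo 9, which forces
    [f = +-1]: this is again a solution of the original equation, with
    [N(a) < N(z)] unless [b] and [c] are units.  So [b], [c] are always units;
    then [B], [C] are equal units up to the common factor, which gives [x = y],
    a unit, and [M] is [2] or [-2]. *)

Require Import Defs.
From HB Require Import structures.
From mathcomp Require Import all_boot all_order all_algebra.
From mathcomp Require Import complex.
From mathcomp Require Import boolp classical_sets functions cardinality reals.
From mathcomp Require Import finmap zify ring lra.

Set Implicit Arguments.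
Unset Strict Implicit.
Unset Printing Implicit Defensive.

Import Order.TTheory GRing.Theory Num.Theory.
Local Open Scope classical_set_scope.
Local Open Scope ring_scope.

(* The pair [(a, b)] stands for [a + b w], where [w^2 + w + 1 = 0]. *)
Definition eis : Type := (int * int)%type.
HB.instance Definition _ := GRing.Zmodule.on eis.

(** * The ring of Eisenstein integers and its norm *)

Definition eis_one : eis := (1, 0).
Definition eis_mul (x y : eis) : eis :=
  (x.1 * y.1 - x.2 * y.2, x.1 * y.2 + x.2 * y.1 - x.2 * y.2).

Lemma eis_mulA : associative eis_mul.
Proof. by move=> [a b] [c d] [e f]; congr pair => /=; ring. Qed.
Lemma eis_mulC : commutative eis_mul.
Proof. by move=> [a b] [c d]; congr pair => /=; ring. Qed.
Lemma eis_mul1 : left_id eis_one eis_mul.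
Proof. by move=> [a b]; congr pair => /=; ring. Qed.
Lemma eis_mulDl : left_distributive eis_mul +%R.
Proof. by move=> [a b] [c d] [e f]; congr pair => /=; ring. Qed.
Lemma eis_oner_neq0 : eis_one != 0.
Proof. by []. Qed.

HB.instance Definition _ := GRing.Zmodule_isComNzRing.Build eis
  eis_mulA eis_mulC eis_mul1 eis_mulDl eis_oner_neq0.

Lemma eisM1 (x y : eis) : (x * y).1 = x.1 * y.1 - x.2 * y.2.
Proof. by []. Qed.
Lemma eisM2 (x y : eis) : (x * y).2 = x.1 * y.2 + x.2 * y.1 - x.2 * y.2.
Proof. by []. Qed.

Definition enorm (x : eis) : int := x.1 ^+ 2 - x.1 * x.2 + x.2 ^+ 2.
(** Complex conjugation: it sends [w] to [w ^+ 2 = - 1 - w]. *)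
Definition econj (x : eis) : eis := (x.1 - x.2, - x.2).

Lemma enormM : {morph enorm : x y / x * y}.
Proof. by move=> x y; rewrite /enorm eisM1 eisM2; ring. Qed.
Lemma enorm_ge0 x : 0 <= enorm x.
Proof. by case: x => a b; rewrite /enorm /=; have := sqr_ge0 (2 * a - b); nra. Qed.
Lemma enorm_eq0 x : (enorm x == 0) = (x == 0).
Proof.
case: x => a b; rewrite /enorm -pair_eqE /pair_eq /=.
apply/eqP/andP => [h|[/eqP-> /eqP->]]; last by [].
have ha := sqr_ge0 (2 * a - b); have hb := sqr_ge0 (2 * b - a).
have: a ^+ 2 == 0 by rewrite eq_le sqr_ge0 andbT; move: h hb; nra.
have: b ^+ 2 == 0 by rewrite eq_le sqr_ge0 andbT; move: h ha; nra.
by rewrite !expf_eq0 /= => -> ->.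
Qed.
Lemma enorm_gt0 (x : eis) : x != 0 -> 0 < enorm x.
Proof. by move=> x0; rewrite lt_neqAle eq_sym enorm_eq0 x0 enorm_ge0. Qed.

Lemma mul_conj x : x * econj x = (enorm x, 0 : int) :> eis.
Proof. by case: x => a b; congr pair; rewrite /enorm /=; ring. Qed.

(** The units are the elements of norm 1, and the inverse of such an element is its conjugate. *)
Definition eis_inv x := if enorm x == 1 then econj x else x.
Lemma eis_mulVr : {in [pred x | enorm x == 1], left_inverse 1 eis_inv *%R}.
Proof.
move=> x; rewrite inE /eis_inv => h; rewrite h mulrC mul_conj (eqP h) //.
Qed.
Lemma eis_unitPl (x y : eis) : y * x = 1 -> enorm x == 1.
Proof.
move=> /(congr1 enorm); rewrite enormM [enorm 1](_ : _ = 1) //.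
move: (enorm_ge0 x) (enorm_ge0 y); case: (enorm x) (enorm y) => // m [] // n _ _.
by case=> /eqP; rewrite muln_eq1 => /andP[_ /eqP ->].
Qed.
Lemma eis_inv_out : {in [predC [pred x | enorm x == 1]], eis_inv =1 id}.
Proof. by move=> x; rewrite !inE /eis_inv => /negbTE ->. Qed.

HB.instance Definition _ := GRing.ComNzRing_hasMulInverse.Build eis
  eis_mulVr eis_unitPl eis_inv_out.

Lemma eis_integral (x y : eis) : x * y = 0 -> (x == 0) || (y == 0).
Proof. by move=> /(congr1 enorm)/eqP; rewrite enormM mulf_eq0 !enorm_eq0. Qed.
HB.instance Definition _ := GRing.ComUnitRing_isIntegral.Build eis eis_integral.

Lemma eis_unitE x : (x \is a GRing.unit) = (enorm x == 1).
Proof. by []. Qed.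

Definition w : eis := (0, 1).
Definition lam : eis := 1 - w.
Lemma w2E : w ^+ 2 = - 1 - w. Proof. by []. Qed.

Lemma enormX x n : enorm (x ^+ n) = enorm x ^+ n.
Proof. by elim: n => [//|n IH]; rewrite !exprS enormM IH. Qed.

Lemma enorm_nat (n : nat) : enorm n%:R = (n ^ 2)%:Z.
Proof.
have -> : n%:R = (n%:Z, 0 : int) :> eis.
  elim: n => [//|n IH]; rewrite -natr1 IH.
  by change ((n%:Z + 1, 0 + 0 : int) = (n.+1%:Z, 0 : int)); congr pair; lia.
by rewrite /enorm /= mulr0 subr0 addr0.
Qed.

Lemma natr_neq0 (n : nat) : (0 < n)%N -> n%:R != 0 :> eis.
Proof. by move=> n0; rewrite -enorm_eq0 enorm_nat; nia. Qed.

(** * Euclidean division, coprimality and coprime factors of a cube *)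

Lemma int_round (s n : int) : 0 < n -> exists q, - n <= 2 * (s - q * n) <= n.
Proof.
(* The witness is the floor of [s / n + 1 / 2]. *)
move=> n0; exists ((2 * s + n) %/ (2 * n))%Z.
have := divz_eq (2 * s + n) (2 * n).
have /= := ltz_pmod (2 * s + n) (_ : 0 < 2 * n).
have := modz_ge0 (2 * s + n) (_ : 2 * n != 0).
set q := (_ %/ _)%Z; set r := (_ %% _)%Z => h1 h2 h3.
have {}h1 := h1 ltac:(lia); have {}h2 := h2 ltac:(lia); nia.
Qed.

(** Both coordinates of [a * econj b / enorm b] are rounded to nearest integers. The errors are at
    most 1/2, so the norm of the error is at most 3/4. *)
Lemma eis_euclid (a b : eis) : b != 0 -> exists q, enorm (a - q * b) < enorm b.
Proof.
move=> b0; have n0 : 0 < enorm b by rewrite lt_neqAle eq_sym enorm_eq0 b0 enorm_ge0.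
have [q1 h1] := int_round (a * econj b).1 n0.
have [q2 h2] := int_round (a * econj b).2 n0.
exists (q1, q2).
rewrite -(ltr_pM2r n0); set q : eis := (q1, q2).
have -> : enorm (a - q * b) * enorm b = enorm (a * econj b - q * (b * econj b)).
  by rewrite mulrA -mulrBl enormM; congr (_ * _); rewrite /enorm /=; ring.
rewrite mul_conj; set n := enorm b in h1 h2 n0 *.
rewrite [X in X < _](_ : _ = let r := (a * econj b).1 - q1 * n in
    let t := (a * econj b).2 - q2 * n in r ^+ 2 - r * t + t ^+ 2); last first.
  by rewrite /enorm [(_ - _).1]/= [(_ - _).2]/= /q eisM1 eisM2 /=; ring.
move: h1 h2; cbv zeta; move: (_ - q1 * n) (_ - q2 * n) => r t h1 h2.
have h3 : 4 * r ^+ 2 <= n ^+ 2 by nra.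
have h4 : 4 * t ^+ 2 <= n ^+ 2 by nra.
have := sqr_ge0 (r + t); nra.
Qed.

Definition edvd (a b : eis) : Prop := exists c, b = c * a.
(** Coprimality is encoded as a Bezout identity, so its consequences are explicit linear
    combinations. *)
Definition ecoprime (a b : eis) : Prop := exists r s, r * a + s * b = 1.

Lemma eis_bezout (a b : eis) :
  exists d, [/\ edvd d a, edvd d b & exists r s, d = r * a + s * b].
Proof.
have [k] := ubnP `|enorm b|%N; elim: k a b => // k IH a b hk.
have [->|b0] := eqVneq b 0.
  by exists a; split; [exists 1; ring | exists 0; ring | exists 1, 0; ring].
have [q hq] := eis_euclid a b0.
have hk' : (`|enorm (a - q * b)%R| < k)%N.
  have := enorm_ge0 (a - q * b); have := enorm_ge0 b; lia.
have [d [[c1 e1] [c2 e2] [r [s e]]]] := IH b _ hk'.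
exists d; split; first by exists (c2 + q * c1); rewrite mulrDl -e2 -mulrA -e1; ring.
  by exists c1.
by exists s, (r - s * q); rewrite e; ring.
Qed.

Lemma ecoprime_sym a b : ecoprime a b -> ecoprime b a.
Proof. by case=> r [s e]; exists s, r; rewrite addrC. Qed.

Lemma ecoprimeMr a b c : ecoprime a b -> ecoprime a c -> ecoprime a (b * c).
Proof.
move=> [r [s e]] [r' [s' e']].
exists (r * r' * a + r * s' * c + s * b * r'), (s * s').
by rewrite -[RHS]mulr1 -{1}e -e'; ring.
Qed.

Lemma ecoprimeXr a b n : ecoprime a b -> ecoprime a (b ^+ n).
Proof.
move=> h; elim: n => [|n IH]; first by exists 0, 1; rewrite expr0; ring.
by rewrite exprS; apply: ecoprimeMr.
Qed.

Lemma ecoprime_dvdr a b c : edvd b c -> ecoprime a c -> ecoprime a b.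
Proof. by move=> [k ->] [r [s e]]; exists r, (s * k); rewrite -mulrA. Qed.

Lemma ecoprime_unit a b : b \is a GRing.unit -> ecoprime a b.
Proof. by move=> h; exists 0, b^-1; rewrite mul0r add0r mulVr. Qed.

Lemma edvd_unit a b : edvd a b -> b \is a GRing.unit -> a \is a GRing.unit.
Proof. by move=> [c ->]; rewrite unitrM => /andP[]. Qed.

Lemma ecoprime_dvd_unit a b : ecoprime a b -> edvd a b -> a \is a GRing.unit.
Proof.
move=> [r [s e]] [c h]; apply: (@edvd_unit _ 1); last exact: unitr1.
by exists (r + s * c); rewrite -e h; ring.
Qed.

Lemma gauss a b c : ecoprime a b -> edvd a (b * c) -> edvd a c.
Proof.
move=> [r [s e]] [k h]; exists (r * c + s * k).
by rewrite -[LHS]mul1r -e mulrDl -(mulrA s) h; ring.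
Qed.

(** The gcd [d] of [A] and [z] is the cube root of [A] up to a unit. Cancelling [d] gives
    [A' * B = z' ^+ 3 * d ^+ 2] with [A'] coprime to [z'], so [d ^+ 2 = k * A'] and
    [B = k * z' ^+ 3]. Then [k] divides the coprime elements [d ^+ 2] and [B], hence is a unit. *)
Lemma cube_split A B z : ecoprime A B -> z != 0 -> A * B = z ^+ 3 ->
  exists e a b, [/\ e \is a GRing.unit, A = e * a ^+ 3,
    B = e^-1 * b ^+ 3 & z = a * b].
Proof.
move=> cAB z0 h.
have [d [[A' eA] [z' ez] [r [s ed]]]] := eis_bezout A z.
have d0 : d != 0 by apply: contraNneq z0 => d0; rewrite ez d0 mulr0.
have A0 : A' != 0.
  have z3 : z ^+ 3 != 0 by rewrite expf_eq0.
  by apply: contraNneq z3 => A0; rewrite -h eA A0 !mul0r.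
have cA'z : ecoprime A' z'.
  exists r, s; apply: (mulIf d0).
  by rewrite mul1r [RHS]ed {1}eA ez; ring.
have h' : A' * B = z' ^+ 3 * d ^+ 2.
  by apply: (mulIf d0); rewrite -[RHS]mulrA -exprSr -exprMn -ez -h eA; ring.
have [k ek] : edvd A' (d ^+ 2).
  apply: (@gauss _ (z' ^+ 3)); first exact: ecoprimeXr.
  by rewrite -h'; exists B; rewrite mulrC.
have eB : B = k * z' ^+ 3 by apply: (mulfI A0); rewrite h' ek; ring.
have uk : k \is a GRing.unit.
  apply: (@ecoprime_dvd_unit _ (d ^+ 2)); last by exists A'; rewrite ek mulrC.
  apply: ecoprimeXr; apply: ecoprime_sym.
  apply: (@ecoprime_dvdr _ _ B); first by exists (z' ^+ 3); rewrite eB mulrC.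
  apply: ecoprime_sym; apply: (@ecoprime_dvdr _ _ A); first by exists A'.
  exact: ecoprime_sym.
exists k^-1, d, z'; split; rewrite ?unitrV ?invrK //; last by rewrite mulrC.
by rewrite eA exprSr ek mulrA mulKr.
Qed.

(** * Inert primes and the six units *)

Lemma enorm_mod3 x : exists t, (enorm x = 3 * t) \/ (enorm x = 3 * t + 1).
Proof.
have -> : enorm x = (x.1 + x.2) ^+ 2 - 3 * (x.1 * x.2) by rewrite /enorm; ring.
have := divz_eq (x.1 + x.2) 3.
have := ltz_pmod (x.1 + x.2) (isT : 0 < 3 :> int).
have := modz_ge0 (x.1 + x.2) (isT : 3 != 0 :> int).
move: (_ %/ _)%Z (_ %% _)%Z (x.1 * x.2) => q r m h1 h2 ->.
have [->|[->|->]] : r = 0 \/ r = 1 \/ r = 2 by lia.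
- by exists (3 * q ^+ 2 - m); left; ring.
- by exists (3 * q ^+ 2 + 2 * q - m); right; ring.
- by exists (3 * q ^+ 2 + 4 * q + 1 - m); right; ring.
Qed.

(** The norm of the gcd of [p] and [x] divides [p ^ 2]. It cannot be [p], since no norm is 2 modulo
    3. *)
Lemma prime_inert (p : nat) x : prime p -> (p %% 3 = 2)%N ->
  edvd p%:R x \/ ecoprime p%:R x.
Proof.
move=> pp p3; have [d [[k ek] [c ec] [r [s ed]]]] := eis_bezout p%:R x.
have := congr1 enorm ek; rewrite enormM enorm_nat.
have := enorm_ge0 k; have := enorm_ge0 d; case: (enorm_mod3 d) => t.
case En : (enorm d) => [n|//] ht; case Ek : (enorm k) => [m|//] _ _ [hm].
have /(dvdn_pfactor _ _ pp)[[|[|[|//]]] _ hn] : (n %| p ^ 2)%N.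
  by rewrite hm dvdn_mull.
- right; have ud : d \is a GRing.unit by rewrite eis_unitE En hn.
  by exists (d^-1 * r), (d^-1 * s); rewrite -!mulrA -mulrDr -ed mulVr.
- by rewrite expn1 in hn; lia.
- left; have uk : k \is a GRing.unit.
    rewrite eis_unitE Ek; move: hm; rewrite hn => /eqP.
    by rewrite -{1}[(p ^ 2)%N]mul1n eqn_pmul2r ?expn_gt0 ?prime_gt0 // => /eqP <-.
  by exists (c * k^-1); rewrite ek -mulrA mulKr.
Qed.

(** As [1 + w = - w ^+ 2], these are the powers of [w] up to sign. The explicit list allows finite
    checks by computation. *)
Definition eis_units : seq eis := [:: 1; -1; w; -w; 1 + w; -1 - w].

Lemma mem_eis_units (e : eis) : e \is a GRing.unit -> e \in eis_units.
Proof.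
rewrite eis_unitE => /eqP; case: e => a b; rewrite /enorm /= => h.
(* Four times the norm is [(2 * a - b) ^+ 2 + 3 * b ^+ 2], which bounds [b], and [a] by symmetry. *)
have hb : -1 <= b <= 1.
  by have : 3 * (b * b) <= 4 by [have := sqr_ge0 (2 * a - b); nra]; nia.
have ha : -1 <= a <= 1.
  by have : 3 * (a * a) <= 4 by [have := sqr_ge0 (2 * b - a); nra]; nia.
have [eb|[eb|eb]] : b = -1 \/ b = 0 \/ b = 1 by lia.
all: have [ea|[ea|ea]] : a = -1 \/ a = 0 \/ a = 1 by lia.
all: by move: h; rewrite ea eb.
Qed.

Lemma unit_cube (e : eis) : e \is a GRing.unit -> e ^+ 3 = 1 \/ e ^+ 3 = -1.
Proof.
move=> /mem_eis_units.
have : all (fun e : eis => (e ^+ 3 == 1) || (e ^+ 3 == -1)) eis_units by [].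
by move=> /allP h /h /orP[] /eqP; [left | right].
Qed.

(** * Congruences modulo [lam] and its cube *)

Definition residues : seq eis := [:: 0; 1; -1].

(** Modulo [lam], [w] is 1 and 3 is 0, so the residue is that of [x.1 + x.2] modulo 3. *)
Lemma mod_lam x : exists s y, s \in residues /\ x = s + lam * y.
Proof.
have := divz_eq (x.1 + x.2) 3.
have := ltz_pmod (x.1 + x.2) (isT : 0 < 3 :> int).
have := modz_ge0 (x.1 + x.2) (isT : 3 != 0 :> int).
move: (_ %/ _)%Z (_ %% _)%Z => q r h1 h2 h.
have [e|[e|e]] : r = 0 \/ r = 1 \/ r = 2 by lia.
- exists 0, (x.1 - q, q); split => //.
  by case: x h => a b /= h; congr pair => /=; lia.
- exists 1, (x.1 - 1 - q, q); split => //.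
  by case: x h => a b /= h; congr pair => /=; lia.
- exists (-1), (x.1 - q, q + 1); split => //.
  by case: x h => a b /= h; congr pair => /=; lia.
Qed.

(* [3 = - w^2 l^2], so the middle terms of the cube are divisible by [l^3]. *)
Lemma cube_mod_lam3 s y : s \in residues ->
  exists t, (s + lam * y) ^+ 3 = s + lam ^+ 3 * t.
Proof.
move=> hs; have s3 : s ^+ 3 = s by move: hs; rewrite !inE => /or3P[]/eqP->.
exists (y ^+ 3 - w ^+ 2 * s ^+ 2 * y - w ^+ 2 * lam * s * y ^+ 2).
by rewrite -{2}s3 /lam; ring: w2E.
Qed.

(* [l^3 = -3 - 6 w] generates the ideal tested here. *)
Definition dvd_lam3 (x : eis) : bool :=
  [&& (3 %| x.1)%Z, (3 %| x.2)%Z & (9 %| x.1 + x.2)%Z].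

Lemma dvd_lam3_mul t : dvd_lam3 (lam ^+ 3 * t).
Proof.
rewrite /dvd_lam3 eisM1 eisM2.
have -> : lam ^+ 3 = (-3, -6) by [].
case: t => a b /=; apply/and3P; split; apply/dvdzP.
- by exists (2 * b - a); ring.
- by exists (b - 2 * a); ring.
- by exists (b - a); ring.
Qed.

(** The values 2, 4, 5, 7 of [r] are the units modulo 9 other than 1 and -1. For the latter two the
    check would fail at [s2 = 0], where [s1 + h * r%:R * s3] can vanish with [s1] nonzero. *)
Lemma local_check : all (fun f : eis => all (fun h : eis => all (fun r : nat =>
  all (fun s1 => all (fun s2 => all (fun s3 =>
    dvd_lam3 (s1 + f * s2 + h * r%:R * s3) ==>
    [&& s1 == 0, s2 == 0 & s3 == 0] ||
    [&& s1 != 0, s2 != 0 & (f == 1) || (f == -1)])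
  residues) residues) residues) [:: 2; 4; 5; 7]%N) eis_units) eis_units.
Proof. by vm_compute. Qed.

(** Modulo [lam ^+ 3] the equation depends only on [b], [c], [a] modulo [lam] and on [n] modulo 9,
    which leaves the cases of [local_check]. *)
Lemma local_unit (f h : eis) (n : nat) (b c a : eis) :
  f \is a GRing.unit -> h \is a GRing.unit -> (n %% 9 \in [:: 2; 4; 5; 7])%N ->
  b ^+ 3 + f * c ^+ 3 + h * n%:R * a ^+ 3 = 0 ->
  [/\ edvd lam b, edvd lam c & edvd lam a] \/
  [/\ ~ edvd lam b, ~ edvd lam c & f = 1 \/ f = -1].
Proof.
move=> uf uh hn.
have [s1 [b1 [hs1 ->]]] := mod_lam b; have [s2 [c1 [hs2 ->]]] := mod_lam c.
have [s3 [a1 [hs3 ->]]] := mod_lam a.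
have [t1 ->] := cube_mod_lam3 b1 hs1; have [t2 ->] := cube_mod_lam3 c1 hs2.
have [t3 ->] := cube_mod_lam3 a1 hs3; move=> heq.
have /allP/(_ _ (mem_eis_units uf))/allP/(_ _ (mem_eis_units uh)) := local_check.
move=> /allP/(_ _ hn)/allP/(_ _ hs1)/allP/(_ _ hs2)/allP/(_ _ hs3)/implyP.
(* [9 = w l^4] lets [n] be reduced modulo 9. *)
have -> : s1 + f * s2 + h * (n %% 9)%:R * s3 = lam ^+ 3 * - (t1 + f * t2
    + h * n%:R * t3 + h * w * lam * (n %/ 9)%:R * s3).
  have en : n%:R = (n %/ 9)%:R * 9 + (n %% 9)%:R :> eis.
    by rewrite {1}(divn_eq n 9) natrD natrM.
  rewrite -[LHS]subr0 -heq en /lam; ring: w2E.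
move=> /(_ (dvd_lam3_mul _)); case/orP.
  case/and3P=> /eqP-> /eqP-> /eqP->; left; split.
  - by exists b1; rewrite add0r mulrC.
  - by exists c1; rewrite add0r mulrC.
  - by exists a1; rewrite add0r mulrC.
(* A nonzero residue has norm 1, while multiples of [lam] have norm divisible by 3. *)
have ndvd s y : s \in residues -> s != 0 -> ~ edvd lam (s + lam * y).
  move=> hs s0 [k e]; have {}e : s = lam * (k - y).
    by rewrite -[LHS](addrK (lam * y)) e; ring.
  have := congr1 enorm e; rewrite enormM (_ : enorm lam = 3) //.
  by move: hs s0; rewrite !inE => /or3P[]/eqP -> //=; rewrite /enorm /=; lia.
case/and3P=> n1 n2 /orP hf; right; split; [exact: ndvd | exact: ndvd |].
by case: hf => /eqP; [left | right].
Qed.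

Lemma ecoprime_lam x y : ecoprime x y -> edvd lam x -> ~ edvd lam y.
Proof.
move=> [r [s e]] [x' hx] [y' hy]; have := congr1 enorm e.
rewrite hx hy !mulrA -mulrDl enormM (_ : enorm lam = 3) // (_ : enorm 1 = 1) //; lia.
Qed.

(** * The three linear factors of a sum of two cubes *)

Lemma factor_split x y : ecoprime x y -> exists mu A B C,
  [/\ mu = 1 \/ mu = lam, A * mu = x + y, B * mu = w * (x + w * y),
      C * mu = w ^+ 2 * (x + w ^+ 2 * y) & A + B + C = 0 /\ ecoprime B C].
Proof.
(* Any two linear factors differ by a unit times [lam * y], so the common factor is [lam] or 1
   according to whether [lam] divides [x + y]. *)
move=> [r [s e]]; have [t [b [ht hb]]] := mod_lam (x + y).
have [t0|t0] := eqVneq t 0.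
  rewrite t0 add0r in hb.
  exists lam, b, (w * b - w * y), (w ^+ 2 * b + w * y).
  have hx : x = lam * b - y by rewrite -hb; ring.
  split; [by right | by rewrite hb mulrC | | | split].
  - by rewrite hx /lam; ring: w2E.
  - by rewrite hx /lam; ring: w2E.
  - by ring: w2E.
  (* Substitute [b = - (B + C)] and [y = w * B - C] in [r * lam * b + (s - r) * y = 1]. *)
  exists (- r * lam + (s - r) * w), (- r * lam - (s - r)).
  by rewrite -e hx /lam; ring: w2E.
have tt : t ^+ 2 = 1 by move: ht t0; rewrite !inE => /or3P[]/eqP->.
exists 1, (x + y), (w * (x + w * y)), (w ^+ 2 * (x + w ^+ 2 * y)).
split; rewrite ?mulr1 //; [by left | split; first by ring: w2E].
set B := w * _; set C := w ^+ 2 * _.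
have hA : x + y = - (B + C) by rewrite /B /C; ring: w2E.
(* Both [lam * x] and [lam * y] are combinations of [B] and [x + y], hence so is [lam]. As [x + y]
   is invertible modulo [lam], the ideal of [B] and [C] contains 1. *)
have hl : lam = r * (w ^+ 2 * (B - w ^+ 2 * (x + y)))
    - s * (w ^+ 2 * (B - w * (x + y))).
  by rewrite -[LHS]mulr1 -e /B /lam; ring: w2E.
have h1 : 1 = t * (x + y) - t * lam * b by rewrite hb -tt; ring.
rewrite hA in h1 hl; move: h1 hl; clearbody B C => h1 hl.
exists (- t - t * b * (r * (w ^+ 2 * (1 + w ^+ 2)) - s * (w ^+ 2 * (1 + w)))),
  (- t - t * b * (r * (w ^+ 2 * w ^+ 2) - s * (w ^+ 2 * w))).
by rewrite [RHS]h1 hl; ring.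
Qed.

Lemma lam_dvd_cube z : edvd lam (z ^+ 3) -> edvd lam z.
Proof.
have [s [t [hs ->]]] := mod_lam z; have [k ->] := cube_mod_lam3 t hs.
move=> [c e]; exists (c - lam ^+ 2 * k + t).
have -> : s = c * lam - lam ^+ 3 * k by rewrite -e; ring.
ring.
Qed.

Lemma ecoprime_sum A B C : A + B + C = 0 -> ecoprime B C -> ecoprime A B.
Proof.
move=> h [r [s e]]; exists (- s), (r - s); rewrite -e.
have -> : C = - (A + B) by rewrite -[C]subr0 -h; ring.
ring.
Qed.

(** This is the triangle inequality for two numbers of absolute value 1, with its equality case,
    checked over the six units. *)
Lemma enorm_unit_sum (b c : eis) : b \is a GRing.unit -> c \is a GRing.unit ->
  enorm (b + c) <= 4 /\ (enorm (b + c) = 4 -> b = c).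
Proof.
move=> /mem_eis_units hb /mem_eis_units hc.
have : all (fun b : eis => all (fun c : eis => (enorm (b + c) <= 4)
  && ((enorm (b + c) == 4) ==> (b == c))) eis_units) eis_units by vm_compute.
move=> /allP/(_ _ hb)/allP/(_ _ hc)/andP[h1 /implyP h2].
by split=> // /eqP/h2/eqP.
Qed.

Lemma sum_cubes_factor (x y : eis) : x ^+ 3 + y ^+ 3 =
  (x + y) * (w * (x + w * y)) * (w ^+ 2 * (x + w ^+ 2 * y)).
Proof. by ring: w2E. Qed.

(** * Descent for the equation [x ^+ 3 + y ^+ 3 = M * z ^+ 3] *)

Section Descent.
Variables (p j : nat) (eps : eis).
Hypotheses (pp : prime p) (p3 : (p %% 3 = 2)%N) (j0 : (0 < j)%N).
Hypothesis (hn : (p ^ j %% 9 \in [:: 2; 4; 5; 7])%N).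
Hypothesis (ueps : eps \is a GRing.unit).
Let M : eis := eps * (p ^ j)%:R.

Lemma twist_neq0 : M != 0.
Proof.
rewrite mulf_neq0 ?natr_neq0 ?expn_gt0 ?prime_gt0 //.
by apply: contraTneq ueps => ->; rewrite unitr0.
Qed.

(** [A] is coprime to [B] and [C], so it absorbs all of [M]. Then [cube_split] applies to [B]
    against [C * A3], and again to [e1 * C] against [A3]. *)
Lemma three_split (A B C z : eis) : A + B + C = 0 -> ecoprime B C -> z != 0 ->
  A * B * C = M * z ^+ 3 -> edvd p%:R A ->
  exists e1 e2 a b c, [/\ e1 \is a GRing.unit, e2 \is a GRing.unit,
    z = a * b * c, B = e1 * b ^+ 3 &
    C = e1^-1 * e2 * c ^+ 3 /\ A = M * e2^-1 * a ^+ 3].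
Proof.
move=> h0 cBC z0 h pA.
have cAB := ecoprime_sum h0 cBC.
have cAC : ecoprime A C.
  by apply: (@ecoprime_sum A C B); [rewrite -h0; ring | exact: ecoprime_sym].
have cpn X : ecoprime A X -> ecoprime (p ^ j)%:R X.
  move=> /ecoprime_sym cX; apply: ecoprime_sym; rewrite natrX; apply: ecoprimeXr.
  exact: ecoprime_dvdr pA cX.
have [A2 eA] : edvd (p ^ j)%:R A.
  apply: (@gauss _ (B * C)); first by apply: ecoprimeMr; exact: cpn.
  by exists (eps * z ^+ 3); rewrite [LHS]mulrC mulrA h /M; ring.
have n0 : (p ^ j)%:R != 0 :> eis by rewrite natr_neq0 ?expn_gt0 ?prime_gt0.
(* [A3] is the quotient of [A] by [M]. *)
set A3 := eps^-1 * A2.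
have dA3 : edvd A3 A.
  by exists ((p ^ j)%:R * eps); rewrite eA /A3 -mulrA mulVKr // mulrC.
have h1 : B * (C * A3) = z ^+ 3.
  apply: (mulfI twist_neq0); rewrite -h eA /M /A3.
  by rewrite -[in RHS](mulVKr ueps A2); ring.
have cB : ecoprime B (C * A3).
  by apply: ecoprimeMr => //; apply: ecoprime_dvdr dA3 _; exact: ecoprime_sym.
have [e1 [b [t [u1 eB h2 ez]]]] := cube_split cB z0 h1.
have t0 : t != 0 by apply: contraNneq z0 => t0; rewrite ez t0 mulr0.
have h3 : (e1 * C) * A3 = t ^+ 3 by rewrite -mulrA h2 mulVKr.
have cC : ecoprime (e1 * C) A3.
  apply: ecoprime_dvdr dA3 _; apply: ecoprime_sym.
  by apply: ecoprimeMr => //; apply: ecoprime_unit.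
have [e2 [c [a [u2 eC eA3 et]]]] := cube_split cC t0 h3.
exists e1, e2, a, b, c; split=> //; first by rewrite ez et; ring.
split; first by rewrite -mulrA -eC mulKr.
by rewrite eA -(mulVKr ueps A2) -/A3 eA3 /M; ring.
Qed.

(** Dividing [A + B + C = 0] by the unit [e1] gives back an equation of the original shape. The last
    clause carries the end of the descent, where [b] and [c] are units, back to [B] and [C]. *)
Lemma descent_step (A B C z : eis) : A + B + C = 0 -> ecoprime B C -> z != 0 ->
  A * B * C = M * z ^+ 3 -> edvd p%:R A ->
  exists b c a, [/\ b ^+ 3 + c ^+ 3 = M * a ^+ 3, ecoprime b c, a != 0,
    enorm z = enorm a * enorm b * enorm c &
    b \is a GRing.unit -> c \is a GRing.unit ->
    B \is a GRing.unit /\ C \is a GRing.unit].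
Proof.
move=> h0 cBC z0 h pA.
have [e1 [e2 [a [b [c [u1 u2 ez eB [eC eA]]]]]]] := three_split h0 cBC z0 h pA.
have cbc : ecoprime b c.
  have db : edvd b B by exists (e1 * b ^+ 2); rewrite eB; ring.
  have dc : edvd c C by exists (e1^-1 * e2 * c ^+ 2); rewrite eC; ring.
  apply: ecoprime_dvdr dc _; apply: ecoprime_sym.
  by apply: ecoprime_dvdr db _; exact: ecoprime_sym.
pose f := e1^-1 ^+ 2 * e2; pose g := e1^-1 * e2^-1 * eps.
have uf : f \is a GRing.unit by rewrite /f unitrM u2 unitrX // unitrV.
have ug : g \is a GRing.unit by rewrite /g !unitrM !unitrV u1 u2.
have hloc : b ^+ 3 + f * c ^+ 3 + g * (p ^ j)%:R * a ^+ 3 = 0.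
  rewrite -[RHS](mulr0 e1^-1) -h0 eA eB eC.
  by rewrite -[in LHS](mulKr u1 (b ^+ 3)) /f /g /M; ring.
have hf : f = 1 \/ f = -1.
  have [[lb lc _]|[_ _ //]] := local_unit uf ug hn hloc.
  by case: (ecoprime_lam cbc lb lc).
have [f3 nf] : f ^+ 3 = f /\ enorm f = 1 by case: hf => ->.
(* Since [f] is 1 or -1 and [e2 = f * e1 ^+ 2], [g] is [f * eps] times the cube of a unit. That cube
   is 1 or -1, so only a sign remains, and a sign is a cube. *)
have [k nk gE] : exists2 k, enorm k = 1 & g = - (eps * k ^+ 3).
  have ee : e2 = f * e1 ^+ 2.
    by rewrite /f mulrAC -exprMn mulVr // expr1n mul1r.
  have ff : f^-1 = f by case: hf => ->; rewrite ?invrN invr1.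
  have {ee ff} : g = f * eps * e1^-1 ^+ 3.
    by rewrite /g ee invrM ?unitrX // ff -exprVn; ring.
  have u1' : e1^-1 \is a GRing.unit by rewrite unitrV.
  case: (unit_cube u1') hf => -> [] -> ->.
  - by exists (-1); rewrite //; ring.
  - by exists 1; rewrite //; ring.
  - by exists 1; rewrite //; ring.
  - by exists (-1); rewrite //; ring.
have k0 : k != 0 by rewrite -enorm_eq0 nk.
clearbody f g; exists b, (f * c), (k * a); split.
- apply/eqP; rewrite -subr_eq0 -hloc gE /M exprMn f3; apply/eqP; ring.
- by apply: ecoprimeMr => //; exact: ecoprime_unit.
- by apply: contraNneq z0 => /eqP; rewrite mulf_eq0 (negbTE k0) /= => /eqP a0;
    rewrite ez a0 !mul0r.
- by rewrite ez !enormM nf nk; ring.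
- rewrite unitrM => ub /andP[_ uc].
  by rewrite eB eC !unitrM unitrV u1 u2 ub uc.
Qed.

(** One round of the descent, with the induction hypothesis as a premise, when [p] divides the first
    linear factor. *)
Lemma descent_dvd (x y z : eis) :
  (forall x' y' z', enorm z' < enorm z -> ecoprime x' y' -> z' != 0 ->
    x' ^+ 3 + y' ^+ 3 = M * z' ^+ 3 -> x' \is a GRing.unit /\ y' \is a GRing.unit) ->
  ecoprime x y -> z != 0 -> x ^+ 3 + y ^+ 3 = M * z ^+ 3 -> edvd p%:R (x + y) ->
  x \is a GRing.unit /\ y \is a GRing.unit.
Proof.
move=> IH cxy z0 h pxy.
have [mu [A [B [C [hmu eA eB eC [h0 cBC]]]]]] := factor_split cxy.
have mu0 : mu != 0 by case: hmu => ->.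
(* Otherwise [p ^ 2], at least 4, would divide the norm of [mu], which is 1 or 3. *)
have cpmu : ecoprime p%:R mu.
  case: (prime_inert mu pp p3) => // -[k ek].
  have := congr1 enorm ek; rewrite enormM enorm_nat.
  have := enorm_ge0 k; have := prime_gt1 pp; have: enorm mu = 1 \/ enorm mu = 3.
    by case: hmu => ->; [left | right].
  case: (enorm k) => // n; nia.
have pA : edvd p%:R A by apply: (gauss cpmu); rewrite mulrC eA.
have hmuz : A * B * C * mu ^+ 3 = M * z ^+ 3.
  by rewrite -h sum_cubes_factor -eA -eB -eC; ring.
have [z1 ez] : edvd mu z.
  have cM : ecoprime mu M.
    apply: ecoprimeMr; first exact: ecoprime_unit.
    by rewrite natrX; apply: ecoprimeXr; exact: ecoprime_sym.
  have dz : edvd mu (z ^+ 3).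
    by apply: (gauss cM); exists (A * B * C * mu ^+ 2); rewrite -hmuz; ring.
  by case: hmu dz => -> dz; [exists z; rewrite mulr1 | exact: lam_dvd_cube].
have z10 : z1 != 0 by apply: contraNneq z0 => z10; rewrite ez z10 mul0r.
have h1 : A * B * C = M * z1 ^+ 3.
  have mu3 : mu ^+ 3 != 0 by rewrite expf_eq0.
  by apply: (mulIf mu3); rewrite hmuz ez; ring.
have [b [c [a [h2 cbc a0 nz uBC]]]] := descent_step h0 cBC z10 h1 pA.
have [ub uc] : b \is a GRing.unit /\ c \is a GRing.unit.
  have zE : enorm z = enorm a * (enorm mu * enorm b * enorm c).
    by rewrite ez enormM nz; ring.
  have n0 (X : eis) : X != 0 -> exists n : nat, enorm X = n.+1.
    by move=> /enorm_gt0; case: (enorm X) => // -[|n] // _; exists n.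
  have bc0 : enorm b * enorm c != 0.
    apply: contraTneq z0 => bc0.
    by rewrite negbK -enorm_eq0 zE -[_ * enorm b * _]mulrA bc0 !mulr0.
  move: bc0; rewrite mulf_eq0 !enorm_eq0 negb_or => /andP[b0 c0].
  have [n1 e1] := n0 _ mu0; have [n3 e3] := n0 _ b0;
  have [n4 e4] := n0 _ c0.
  (* Either the new solution is smaller and the induction hypothesis applies to it, or the norms of
     [b] and [c] are forced to be 1. *)
  have [lt|ge] := ltP (enorm a) (enorm z); first exact: (IH b c a).
  move: ge; rewrite !eis_unitE zE -[leRHS]mulr1 (ler_pM2l (enorm_gt0 a0)) e1 e3 e4.
  rewrite -!PoszM lez_nat => le1.
  have [-> ->] : n3 = 0%N /\ n4 = 0%N by clear - le1; nia.
  by [].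
have [uB uC] := uBC ub uc.
have [le4 eq4] := enorm_unit_sum uB uC.
have nA : enorm A = enorm (B + C).
  have -> : A = - (B + C) by rewrite -[A]subr0 -h0; ring.
  by rewrite -mulN1r enormM mul1r.
(* The norm of [A] is at most 4 as that of a sum of two units, and at least [p ^ 2] as [p] divides
   [A]. So it is 4, the equality case. *)
have BC : B = C.
  apply: eq4; case: pA => k ek.
  have A0 : A != 0.
    have : A * B * C != 0 by rewrite h1 mulf_neq0 ?expf_neq0 ?twist_neq0.
    by rewrite !mulf_eq0 !negb_or => /andP[/andP[]].
  have hp : (4 <= p ^ 2)%N by rewrite -[4%N]/(2 ^ 2)%N leq_exp2r // prime_gt1.
  have := enorm_gt0 A0; move: nA le4; rewrite ek enormM enorm_nat => <-.
  case: (enorm k) (enorm_ge0 k) => // n _; move: (p ^ 2)%N hp => m; clear.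
  by case: n => [|[|n]]; rewrite -?PoszM ?lez_nat ?mulSn; [lia | lia | nia].
have exy : y = x.
  apply/eqP; rewrite eq_sym -subr_eq0; apply/eqP.
  apply: (mulfI (_ : w - w ^+ 2 != 0)) => //; rewrite mulr0.
  by transitivity (B * mu - C * mu); [rewrite eB eC; ring: w2E | rewrite BC subrr].
have ux : x \is a GRing.unit.
  by case: cxy => r [s e]; apply: (@eis_unitPl _ (r + s)); rewrite -e exy; ring.
by rewrite exy.
Qed.

Lemma descent (x y z : eis) : ecoprime x y -> z != 0 ->
  x ^+ 3 + y ^+ 3 = M * z ^+ 3 -> x \is a GRing.unit /\ y \is a GRing.unit.
Proof.
have [k] := ubnP `|enorm z|%N; elim: k x y z => // k IH x y z hk cxy z0 h.
have IH' x' y' z' : enorm z' < enorm z -> ecoprime x' y' -> z' != 0 ->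
    x' ^+ 3 + y' ^+ 3 = M * z' ^+ 3 -> x' \is a GRing.unit /\ y' \is a GRing.unit.
  by move=> lt; apply: IH; have := enorm_ge0 z'; move: lt hk; clear; lia.
have w3 : w ^+ 3 = 1 by [].
(* Replacing [y] by [e * y] preserves [y ^+ 3], so any of the three linear factors can be made the
   first. *)
have twisted e : e ^+ 3 = 1 -> e \is a GRing.unit -> edvd p%:R (x + e * y) ->
    x \is a GRing.unit /\ y \is a GRing.unit.
  move=> e3 ue he.
  have := @descent_dvd x (e * y) z IH' _ z0 _ he.
  rewrite exprMn e3 mul1r unitrM ue; apply=> //.
  by apply: ecoprimeMr => //; exact: ecoprime_unit.
have pd : edvd p%:R ((x + y) * ((x + w * y) * (x + w ^+ 2 * y))).
  exists (eps * (p ^ j.-1)%:R * z ^+ 3).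
  transitivity (x ^+ 3 + y ^+ 3); first by ring: w2E.
  by rewrite h /M -(prednK j0) expnSr natrM; ring.
case: (prime_inert (x + y) pp p3) => [hd|/gauss/(_ pd){}pd].
  by apply: (twisted 1); rewrite ?expr1n ?mul1r ?unitr1.
case: (prime_inert (x + w * y) pp p3) => [|/gauss/(_ pd){}pd]; first exact: twisted.
exact: (twisted (w ^+ 2)).
Qed.

Hypothesis j2 : (j <= 2)%N.

(** If [p] divides [g], comparing norms shows that [p ^ 6] divides [p ^ (2 * j)], against [j <= 2].
    Otherwise [g] is coprime to [p] and its cube divides [eps]. *)
Lemma cube_dvd_twist g : edvd (g ^+ 3) M -> g \is a GRing.unit.
Proof.
move=> dM; case: (prime_inert g pp p3) => [[c eg]|cpg].
  case: dM => k ek; have := congr1 enorm ek.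
  rewrite /M eg !exprS expr0 mulr1 !enormM (eqP (ueps : enorm eps == 1)) mul1r !enorm_nat.
  case: (enorm c) (enorm_ge0 c) (enorm k) (enorm_ge0 k) => // m _ [] // n _ [] hN.
  have : (p ^ 6 %| p ^ (2 * j))%N.
    apply/dvdnP; exists (n * (m * (m * m)))%N.
    by rewrite mulnC expnM hN (expnM p 2 3) !expnS expn0; ring.
  by rewrite dvdn_Pexp2l ?prime_gt1 //; move: j2; clear; lia.
have /edvd_unit/(_ ueps) : edvd (g ^+ 3) eps.
  apply: (@gauss _ (p ^ j)%:R); last by rewrite mulrC.
  rewrite natrX; apply/ecoprimeXr/ecoprime_sym/ecoprimeXr => //.
by rewrite unitrX_pos.
Qed.

Theorem sum_cubes_twist (x y z : eis) : z != 0 -> x ^+ 3 + y ^+ 3 = M * z ^+ 3 ->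
  x ^+ 3 = y ^+ 3 /\ (M = 2%:R \/ M = - 2%:R).
Proof.
move=> z0 h; have [d [[x1 ex] [y1 ey] [r [s ed]]]] := eis_bezout x y.
have d0 : d != 0.
  have Mz : M * z ^+ 3 != 0 by rewrite mulf_neq0 ?twist_neq0 ?expf_neq0.
  by apply: contraNneq Mz => d0; rewrite -h ex ey d0 !mulr0 expr0n addr0.
have cxy : ecoprime x1 y1.
  by exists r, s; apply: (mulIf d0); rewrite mul1r [RHS]ed ex ey; ring.
(* The gcd [d] of [x] and [y] is moved to the other side. Once it is reduced against [z], the cube
   of [d'] divides [M], so [d'] is a unit and [z' / d'] is integral. *)
have [g [[d' ed'] [z' ez'] [r' [s' eg]]]] := eis_bezout d z.
have g0 : g != 0 by apply: contraNneq d0 => g0; rewrite ed' g0 mulr0.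
have cdz : ecoprime d' z'.
  by exists r', s'; apply: (mulIf g0); rewrite mul1r [RHS]eg ed' ez'; ring.
have h' : d' ^+ 3 * (x1 ^+ 3 + y1 ^+ 3) = z' ^+ 3 * M.
  have g3 : g ^+ 3 != 0 by rewrite expf_eq0.
  apply: (mulIf g3); transitivity (x ^+ 3 + y ^+ 3); first by rewrite ex ey ed'; ring.
  by rewrite h ez'; ring.
have ud : d' \is a GRing.unit.
  apply: cube_dvd_twist; apply: (@gauss _ (z' ^+ 3)).
    by apply/ecoprimeXr/ecoprime_sym/ecoprimeXr/ecoprime_sym.
  by exists (x1 ^+ 3 + y1 ^+ 3); rewrite -h' mulrC.
pose t := z' * d'^-1.
have ht : x1 ^+ 3 + y1 ^+ 3 = M * t ^+ 3.
  apply: (mulrI (unitrX 3 ud)); rewrite h' /t exprMn exprVn.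
  by rewrite -[LHS]mulr1 -(divrr (unitrX 3 ud)); ring.
have t0 : t != 0.
  rewrite /t mulf_neq0 ?invr_eq0 //.
    by apply: contraNneq z0 => z0'; rewrite ez' z0' mul0r.
  by apply: contraTneq ud => ->; rewrite unitr0.
clearbody t; have [ux uy] := descent cxy t0 ht.
(* Cubes of units are 1 or -1, and opposite signs would make the sum vanish. *)
have xy3 : x1 ^+ 3 = y1 ^+ 3 /\ (x1 ^+ 3 = 1 \/ x1 ^+ 3 = -1).
  have M0 : M * t ^+ 3 != 0 by rewrite mulf_neq0 ?twist_neq0 ?expf_neq0.
  move: M0; rewrite -ht.
  case: (unit_cube ux) (unit_cube uy) => -> [] -> //; rewrite ?subrr ?addNr ?eqxx //.
    by split=> //; left.
  by split=> //; right.
split; first by rewrite ex ey !exprMn xy3.1.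
(* The norm of [M * t ^+ 3] is that of 2 or -2, namely 4, and [M] alone already has norm at least
   4. *)
have ut : t \is a GRing.unit.
  have := congr1 enorm ht; rewrite -xy3.1 [in RHS]enormM enormX [enorm M]enormM.
  rewrite (eqP (ueps : enorm eps == 1)) mul1r enorm_nat.
  have -> : enorm (x1 ^+ 3 + x1 ^+ 3) = 4 by case: xy3.2 => ->.
  have hp : (4 <= (p ^ j) ^ 2)%N.
    have hpj : (p <= p ^ j)%N by rewrite -{1}(expn1 p) leq_pexp2l // prime_gt0.
    by rewrite -[4%N]/(2 ^ 2)%N leq_exp2r //; exact: leq_trans (prime_gt1 pp) hpj.
  have := enorm_gt0 t0; rewrite eis_unitE; case: (enorm t) => // n.
  move: ((p ^ j) ^ 2)%N hp => m; clear.
  by case: n => [|[|n]] // hm _; rewrite !exprS expr0 mulr1; nia.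
case: xy3 ht => <- [] -> ht; case: (unit_cube ut) => et; rewrite et in ht.
- by left; rewrite -[M]mulr1 -ht.
- by right; rewrite -[M]opprK -[X in - X]mulrN1 -ht.
- by right; rewrite -[M]mulr1 -ht.
- by left; rewrite -[M]opprK -[X in - X]mulrN1 -ht.
Qed.
End Descent.

Lemma card_set_seq (T : choiceType) (s : seq T) :
  uniq s -> ([set` s] #= `I_(size s))%card.
Proof.
move=> us; have -> : [set` s] = [set` [fset x in s]%fset].
  by apply/seteqP; split=> x /=; rewrite !inE.
by apply/card_eq_fsetP; rewrite card_fseq undup_id.
Qed.

(** * Transfer to a field containing the two roots *)

Section Embedding.
Variables (F : numFieldType) (u v : F).
Hypothesis huv : two_roots u v.

Lemma root_u : u ^+ 2 = - 1 - u.
Proof.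
have /huv.2 h : u = u \/ u = v by left.
by rewrite -[LHS]subr0 -h; ring.
Qed.

(** [- 1 - u] is also a root. Were it equal to [u], then [2 * u = - 1] would give
    [4 * (u ^+ 2 + u + 1) = 3]. *)
Lemma root_v : v = - 1 - u.
Proof.
have : (- 1 - u) ^+ 2 + (- 1 - u) + 1 = 0 by ring: root_u.
case/huv.2 => // e.
have e2 : 2 * u = - 1 by rewrite mulrDl mul1r -{1}e; ring.
have : 4 * (u ^+ 2 + u + 1) = 3.
  transitivity ((2 * u) ^+ 2 + 2 * (2 * u) + 4); [by ring | by rewrite e2; ring].
have /huv.2 -> : u = u \/ u = v by left.
by rewrite mulr0 => /eqP; rewrite eq_sym pnatr_eq0.
Qed.

(** The ring embedding that sends [w] to [u]. *)
Definition phi (x : eis) : F := x.1%:~R + x.2%:~R * u.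

Lemma phiD x y : phi (x + y) = phi x + phi y.
Proof. by rewrite /phi !intrD; ring. Qed.

Lemma phiM x y : phi (x * y) = phi x * phi y.
Proof. by rewrite /phi eisM1 eisM2 !(intrD, intrM, rmorphN); ring: root_u. Qed.

Lemma phi1 : phi 1 = 1.
Proof. by rewrite /phi mul0r addr0. Qed.

Lemma phiN x : phi (- x) = - phi x.
Proof. by rewrite /phi !rmorphN /=; ring. Qed.

Lemma phi_int (d : int) : phi ((d, 0 : int) : eis) = d%:~R.
Proof. by rewrite /phi mul0r addr0. Qed.

Lemma phiX x n : phi (x ^+ n) = phi x ^+ n.
Proof. by elim: n => [|n IH]; rewrite ?phi1 // !exprS phiM IH. Qed.

Lemma phi_nat n : phi n%:R = n%:R.
Proof.
elim: n => [|n IH]; first by rewrite /phi mul0r addr0.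
by rewrite -!natr1 phiD IH phi1.
Qed.

(** The product of [phi x] and [phi (econj x)] is the norm of [x], and the characteristic is 0. *)
Lemma phi_eq0 x : phi x = 0 -> x = 0.
Proof.
move=> h; apply/eqP; rewrite -enorm_eq0 -(intr_eq0 F) -phi_int -mul_conj.
by rewrite phiM h mul0r.
Qed.

Lemma phi_inj : injective phi.
Proof.
move=> x y h; apply/eqP; rewrite -subr_eq0; apply/eqP/phi_eq0.
by rewrite phiD phiN h subrr.
Qed.

Lemma eisO_phi z : eisO u v z -> exists x, z = phi x.
Proof.
move=> [a [b [c ->]]]; exists (a - c, b - c).
by rewrite /phi /= root_v !rmorphB /=; ring.
Qed.

Lemma eis_unit_phi e : eis_unit u v e ->
  exists2 x : eis, x \is a GRing.unit & e = phi x.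
Proof.
move=> [/eisO_phi[x ->] [f [/eisO_phi[y ->]]]]; rewrite -phiM -phi1 => /phi_inj h.
by exists x => //; apply: (@eis_unitPl _ y); rewrite mulrC.
Qed.

Lemma eisK_phi z : eisK u v z ->
  exists (d : int) (x : eis), d != 0 /\ z * d%:~R = phi x.
Proof.
move=> [a [b [c ->]]].
exists (denq a * denq b * denq c), (numq a * denq b * denq c - numq c * denq a * denq b,
  numq b * denq a * denq c - numq c * denq a * denq b).
split; first by rewrite !mulf_neq0 ?denq_neq0.
rewrite /phi /= root_v /ratr !rmorphB !rmorphM /=.
by field; rewrite !intr_eq0 !denq_neq0.
Qed.

(** Multiplying by the common denominator [d * d'] gives an equation in [eis] with [z] equal to that
    denominator. *)
Lemma sum_cubes_eisK (p j : nat) (eps : eis) (x y M : F) : prime p ->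
  (p %% 3 = 2)%N -> (0 < j <= 2)%N -> (p ^ j %% 9 \in [:: 2; 4; 5; 7])%N ->
  eps \is a GRing.unit -> M = phi eps * p%:R ^+ j ->
  eisK u v x -> eisK u v y -> x ^+ 3 + y ^+ 3 = M ->
  x ^+ 3 = y ^+ 3 /\ (M = 2 \/ M = - 2).
Proof.
move=> pp p3 /andP[j0 j2] hn ue MP.
move=> /eisK_phi[d [X [d0 eX]]] /eisK_phi[d' [Y [d'0 eY]]] h.
pose X1 : eis := X * (d', 0 : int); pose Y1 : eis := Y * (d, 0 : int).
pose Z1 : eis := (d * d', 0 : int).
have Z0 : Z1 != 0 by rewrite -pair_eqE /pair_eq /= eqxx andbT mulf_neq0.
have eX1 : phi X1 = x * phi Z1.
  by rewrite phiM !phi_int -eX intrM; ring.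
have eY1 : phi Y1 = y * phi Z1.
  by rewrite phiM !phi_int -eY intrM; ring.
have ME : M = phi (eps * (p ^ j)%:R) by rewrite phiM phi_nat natrX.
have hE : X1 ^+ 3 + Y1 ^+ 3 = eps * (p ^ j)%:R * Z1 ^+ 3.
  by apply: phi_inj; rewrite phiD phiM -ME -h !phiX eX1 eY1; ring.
have pZ : phi Z1 != 0 by apply: contra Z0 => /eqP/phi_eq0 ->.
have [e3 hM] := sum_cubes_twist pp p3 j0 hn ue j2 Z0 hE.
split.
  have Z3 : phi Z1 ^+ 3 != 0 by rewrite expf_neq0.
  by apply: (mulIf Z3); rewrite -!exprMn -eX1 -eY1 -!phiX e3.
by rewrite ME; case: hM => ->; [left | right]; rewrite ?phiN phi_nat.
Qed.

Lemma cube_roots c x : c ^+ 2 = 1 ->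
  x ^+ 3 = c <-> x \in [:: c; c * u; c * v].
Proof.
move=> c2; have c3 : c ^+ 3 = c by rewrite exprS c2 mulr1.
have u3 : u ^+ 3 = 1 by ring: root_u.
have v3 : v ^+ 3 = 1 by rewrite root_v; ring: root_u.
split=> [h|]; last first.
  by rewrite !inE => /or3P[]/eqP->; rewrite ?exprMn ?u3 ?v3 ?mulr1.
(* As [c ^+ 2 = 1], the quadratic cofactor of [x - c] in [x ^+ 3 - c ^+ 3] is the defining
   polynomial of [u] and [v] at [x * c]. *)
have : (x - c) * ((x * c) ^+ 2 + x * c + 1) = 0.
  transitivity (x ^+ 3 * c ^+ 2 - c ^+ 3 + x * (1 - c ^+ 2)); first by ring: c2.
  by rewrite c2 h c3; ring.
move=> /eqP; rewrite mulf_eq0 subr_eq0 !inE => /orP[-> //|/eqP/huv.2 hxc].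
have xE : x = c * (x * c) by rewrite mulrCA -expr2 c2 mulr1.
by rewrite xE; case: hxc => ->; rewrite eqxx ?orbT.
Qed.

Lemma card_cubes_equal c : c = 1 \/ c = - 1 ->
  (cubes_equal u v c #= `I_9)%card.
Proof.
move=> hc; have c2 : c ^+ 2 = 1 by case: hc => ->; ring.
have c0 : c != 0 by case: hc => ->; rewrite ?oppr_eq0 oner_eq0.
pose s := [:: c; c * u; c * v].
have us : uniq s.
  (* If [u = 1], or if [v = 1] and so [u = - 2], then [u ^+ 2 + u + 1] would be 3. *)
  have three : 3 != 0 :> F by rewrite pnatr_eq0.
  have u1 : 1 != u.
    apply: contraNneq three => u1; apply/eqP.
    by transitivity (u ^+ 2 - (- 1 - u)); [rewrite -u1; ring | rewrite root_u subrr].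
  have v1 : 1 != v.
    rewrite root_v; apply: contraNneq three => v1; apply/eqP.
    have uE : u = - 2 by rewrite -[u]opprK -[- u](addKr (- 1)) -v1; ring.
    by transitivity (u ^+ 2 - (- 1 - u)); [rewrite uE; ring | rewrite root_u subrr].
  rewrite /= !inE !negb_or andbT -{1 3}[c]mulr1 !(inj_eq (mulfI c0)) u1 v1.
  exact: huv.1.
have [q qc] : exists q : rat, c = ratr q.
  by case: hc => ->; [exists 1 | exists (- 1)]; rewrite ?rmorphN rmorph1.
have sK a : a \in s -> eisK u v a.
  rewrite !inE => /or3P[]/eqP->; rewrite qc.
  - by exists q, 0, 0; rewrite !rmorph0 !mul0r !addr0.
  - by exists 0, q, 0; rewrite !rmorph0 !mul0r add0r addr0.
  - by exists 0, 0, q; rewrite !rmorph0 !mul0r !add0r.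
have hs x : x ^+ 3 = c <-> x \in s by exact: cube_roots.
have s3 : size s = 3%N by [].
clearbody s; have -> : cubes_equal u v c = [set` allpairs pair s s].
  apply/seteqP; split=> [[x y] /= [_ [_ [hx hy]]]|[x y] /=].
    by apply/allpairsP; exists (x, y); split=> //=; apply/hs.
  move=> /allpairsP/=[[a b] [/= ha hb [-> ->]]].
  by split; [exact: sK | split; [exact: sK | split; apply/hs]].
have <- : size (allpairs pair s s) = 9%N by rewrite size_allpairs s3.
apply: card_set_seq.
by apply: allpairs_uniq => // -[a b] [a' b'].
Qed.
End Embedding.

Theorem theorem1p3 (R : realType) (u v : R[i]) (huv : two_roots u v)
    (p : nat) (p_prime : prime p)
    (p_mod9 : (p = 2 %[mod 9])%N \/ (p = 5 %[mod 9])%N)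
    (M : R[i])
    (hM : eis_associates u v M p%:R \/ eis_associates u v M (p%:R ^+ 2)) :
  [/\ M <> 2 -> M <> - 2 ->
        ~ exists x y : R[i], eisK u v x /\ eisK u v y /\ x ^+ 3 + y ^+ 3 = M,
      M = 2 ->
        cube_solutions u v M = cubes_equal u v 1 /\
        (cubes_equal u v 1 #= `I_9)%card &
      M = - 2 ->
        cube_solutions u v M = cubes_equal u v (- 1) /\
        (cubes_equal u v (- 1) #= `I_9)%card].
Proof.
have p3 : (p %% 3 = 2)%N by case: p_mod9 => h; lia.
have [j [eps [hj hn ue ME]]] : exists j (eps : eis), [/\ (0 < j <= 2)%N,
    (p ^ j %% 9 \in [:: 2; 4; 5; 7])%N, eps \is a GRing.unit &
    M = phi u eps * p%:R ^+ j].
  case: hM => -[_ _ [e [/(eis_unit_phi huv)[eps ue ->] ->]] _].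
    exists 1%N, eps; split; rewrite // ?expn1 1?mulrC //.
    by case: p_mod9 => ->.
  exists 2%N, eps; split; rewrite // 1?mulrC //.
  (* The squares of 2 and 5 are 4 and 7 modulo 9. *)
  by rewrite -modnXm; case: p_mod9 => ->.
have main x y := @sum_cubes_eisK _ u v huv p j eps x y M p_prime p3 hj hn ue ME.
(* Two equal cubes with sum [c + c] are both [c]; this serves [c = 1] and [c = - 1]. *)
have solutions c : M = c + c -> cube_solutions u v M = cubes_equal u v c.
  move=> Mc; apply/seteqP; split=> -[x y] /= [hx [hy]]; last first.
    by case=> xc yc; split=> //; split=> //; rewrite xc yc.
  move=> h; have [e _] := main x y hx hy h.
  have xc : x ^+ 3 = c.
    apply: (mulfI (_ : 2 != 0)); first by rewrite pnatr_eq0.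
    by rewrite !mulr_natl !mulr2n -Mc -h /= e.
  by split=> //; split=> //; split; rewrite /= -?e.
split.
- move=> M2 Mn2 [x [y [hx [hy h]]]].
  by case: (main x y hx hy h) => _ [].
- move=> M2; split; last by apply: (card_cubes_equal huv); left.
  by apply: solutions; rewrite M2.
- move=> M2; split; last by apply: (card_cubes_equal huv); right.
  by apply: solutions; rewrite M2; ring.
Qed.
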